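(* The uniform unicycle walk on the complete graph $K_m$ (with self-loops) exhibits cutoff at time $m\log m$ as $m\to\infty$; that is, for every $\varepsilon\in(0,1)$, $$\lim_{m\to\infty}\frac{t^{(m)}_{\mathrm{mix}}(\varepsilon)}{t^{(m)}_{\mathrm{mix}}(1-\varepsilon)}=1\qquad\text{and}\qquad \lim_{m\to\infty}\frac{t^{(m)}_{\mathrm{mix}}(\varepsilon)}{m\log m}=1 .$$
   Context: $K_m$ is the complete directed graph with self-loops: vertex set $V=\{1,\dots,m\}$ and edge set $\{(i,j):i,j\in\{1,\dots,m\}\}$. $\mathsf{U}_{K_m}$ is the set of unicycle configurations: pairs $(x,\rho)$ with $x\in V$ and $\rho:V\to V$ such that the directed graph with edges $\{(v,\rho(v)):v\in V\}$ contains exactly one directed cycle (a self-loop $\rho(v)=v$ counts as a cycle), and $x$ lies on that cycle. Equivalently, $\{(v,\rho(v)):v\neq x\}$ is a spanning tree directed towards the root $x$. The uniform unicycle walk on $K_m$ is the Markov chain on $\mathsf{U}_{K_m}$ which from $(x,\rho)$ chooses $y\in V$ uniformly at random and moves to $(y,\eta)$, where $\eta(x)=y$ and $\eta(v)=\rho(v)$ for $v\ne x$. Let $p^{(t)}$ be its $t$-step transition probabilities and $\mu^{(m)}$ its stationary distribution. The mixing time is $$t^{(m)}_{\mathrm{mix}}(\varepsilon)=\min\Big\{t\in\mathbb{N}:\ \max_{(y,\eta)\in\mathsf{U}_{K_m}}\big\|p^{(t)}((y,\eta),\cdot)-\mu^{(m)}\big\|_{\mathrm{TV}}<\varepsilon\Big\},$$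 with $\|\iota-\zeta\|_{\mathrm{TV}}=\tfrac12\sum_{s}|\iota(s)-\zeta(s)|$. *)

(* Defs.v *)
From HB Require Import structures.
From mathcomp Require Import all_boot all_order all_algebra.
From mathcomp Require Import all_classical all_reals all_analysis.
Set Implicit Arguments.
Unset Strict Implicit.
Unset Printing Implicit Defensive.
Import Order.TTheory GRing.Theory Num.Theory.
Import numFieldNormedType.Exports.
Local Open Scope classical_set_scope.
Local Open Scope ring_scope.

Section MarkovChain.
Variables (R : realType) (T : finType).
Implicit Types (P : T -> T -> R) (mu nu : T -> R) (e : R).

Fixpoint tstep P (t : nat) (s s' : T) : R :=
  if t is t'.+1 then \sum_(u : T) P s u * tstep P t' u s' else (s == s')%:R.

Definition is_stationary P mu : Prop :=
  [/\ forall s, 0 <= mu s, \sum_(s : T) mu s = 1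
    & forall s', \sum_(s : T) mu s * P s s' = mu s'].

(* The zero function is a junk value, for chains with no stationary
   distribution. *)
Definition stationary P : T -> R := xget (fun=> 0) [set mu | is_stationary P mu].

Definition tv_dist mu nu : R := 2^-1 * \sum_(s : T) `|mu s - nu s|.

(* Distances are nonnegative, so the default value 0 of the maximum matters only
   if T is empty. *)
Definition worst_dist P (t : nat) : R :=
  \big[Num.max/0]_(s : T) tv_dist (tstep P t s) (stationary P).

(* The minimum of {t | worst_dist P t < e}; 0 is a junk value, for the case where
   that set is empty. *)
Definition mixing_time P e : nat :=
  xget 0%N [set t | worst_dist P t < e /\
                    forall t', worst_dist P t' < e -> (t <= t')%N].

End MarkovChain.

Section UnicycleWalk.
Variable m : nat.
Implicit Types (x y v : 'I_m) (rho : {ffun 'I_m -> 'I_m}) (c : seq 'I_m).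

(* A directed cycle of the graph with edges (v, rho v), listed from one of its
   vertices; the list [:: v] is a self-loop when rho v = v. *)
Definition directed_cycle rho c : Prop :=
  [/\ c != [::], uniq c & fcycle rho c].

(* There is exactly one directed cycle, up to the choice of its first vertex, and
   x lies on it. *)
Definition is_unicycle x rho : Prop :=
  exists c, [/\ directed_cycle rho c, x \in c
              & forall c', directed_cycle rho c' -> exists i, c' = rot i c].

Definition unicycle : finType :=
  {s : 'I_m * {ffun 'I_m -> 'I_m} | `[< is_unicycle s.1 s.2 >]}.

Definition move (s : 'I_m * {ffun 'I_m -> 'I_m}) y :
    'I_m * {ffun 'I_m -> 'I_m} :=
  (y, [ffun v => if v == s.1 then y else s.2 v]).

Definition unicycle_walk (R : realType) (s s' : unicycle) : R :=
  #|[pred y : 'I_m | val s' == move (val s) y]|%:R / m%:R.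

End UnicycleWalk.

Definition unicycle_tmix (R : realType) (m : nat) (e : R) : nat :=
  mixing_time (@unicycle_walk m R) e.

(* Main.v *)
(* After the first step the walk only records where it was last sent from each
   vertex, so two walks fed with the same random vertices y_1, y_2, ... agree as
   soon as these have visited every vertex: the coupon collector bound
   m (1 - 1/m)^t gives the upper estimate.  For the lower estimate, start with
   every arrow pointing to v0.  An arrow not yet rewritten still points to v0, and
   by Chebyshev's inequality about a = (m - 1)(1 - 1/m)^t arrows are left after t
   steps, whereas under any stationary law the expected in-degree of v0 (other
   than its own arrow) is at most 1. *)
Require Import Defs.
From HB Require Import structures.
From mathcomp Require Import all_boot all_order all_algebra.
From mathcomp Require Import all_classical all_reals all_analysis.
From mathcomp Require Import ring lra.
Set Implicit Arguments.
Unset Strict Implicit.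
Unset Printing Implicit Defensive.
Import Order.TTheory GRing.Theory Num.Theory.
Import numFieldNormedType.Exports.
Local Open Scope classical_set_scope.
Local Open Scope ring_scope.

(** * Finite Markov chains *)

Definition stochastic (R : realType) (T : finType) (P : T -> T -> R) : Prop :=
  (forall s s', 0 <= P s s') /\ (forall s, \sum_s' P s s' = 1).

Definition markov_op (R : realType) (T : finType) (P : T -> T -> R)
    (f : T -> R) (s : T) : R :=
  \sum_s' P s s' * f s'.

(** Row sums 1 make the constant column a right fixed vector, so [M - 1] is singular; being square,
    it also has a nonzero left kernel. *)
Lemma left_fixed_vector (R : realType) (T : finType) (P : T -> T -> R) (s0 : T) :
  (forall s, \sum_s' P s s' = 1) ->
  exists2 v : T -> R, exists s, v s != 0 &
    forall s', \sum_s v s * P s s' = v s'.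
Proof.
move=> P1.
pose M : 'M[R]_#|T| := \matrix_(i, j) P (enum_val i) (enum_val j).
have M1 : M *m const_mx 1 = const_mx 1 :> 'cV[R]_#|T|.
  apply/matrixP=> i j; rewrite !mxE -[RHS](P1 (enum_val i)) [RHS]big_enum_val /=.
  by apply: eq_bigr => k _; rewrite !mxE mulr1.
have : eigenvalue M 1.
  rewrite /eigenvalue /eigenspace kermx_eq0; apply/negP => Mfree.
  have Mu : M - 1%:M \in unitmx by rewrite -row_free_unit.
  have : const_mx 1 = 0 :> 'cV[R]_#|T|.
    by rewrite -(mulKmx Mu (const_mx 1)) mulmxBl M1 mul1mx subrr mulmx0.
  move=> /matrixP /(_ (enum_rank s0) 0); rewrite !mxE => /eqP.
  by rewrite oner_eq0.
case/eigenvalueP => v vM v0; exists (fun s => v 0 (enum_rank s)).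
  case/rV0Pn: v0 => j vj; exists (enum_val j); by rewrite enum_valK.
move=> s'; have /matrixP /(_ 0 (enum_rank s')) := vM.
rewrite scale1r mxE => <-; rewrite big_enum_val /=.
by apply: eq_bigr => k _; rewrite !mxE enum_valK enum_rankK.
Qed.

(* If v = v P, then |v| <= |v| P, and the two sides have the same total mass. *)
Lemma stationary_exists (R : realType) (T : finType) (P : T -> T -> R) (s0 : T) :
  stochastic P -> exists mu, is_stationary P mu.
Proof.
move=> [P0 P1]; have [v [s1 v1] vP] := left_fixed_vector s0 P1.
pose S := \sum_s `|v s|.
have S0 : 0 < S.
  by rewrite /S (bigD1 s1) //= ltr_pwDl ?normr_gt0 ?sumr_ge0.
have Sne : S != 0 by rewrite gt_eqF.
have le s' : `|v s'| <= \sum_s `|v s| * P s s'.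
  rewrite -vP; apply: le_trans (ler_norm_sum _ _ _) _.
  by apply: ler_sum => s _; rewrite normrM (ger0_norm (P0 _ _)).
have tot : \sum_s' (\sum_s `|v s| * P s s' - `|v s'|) == 0.
  rewrite sumrB exchange_big /= subr_eq0; apply/eqP.
  by apply: eq_bigr => s _; rewrite -mulr_sumr P1 mulr1.
have abs s' : \sum_s `|v s| * P s s' = `|v s'|.
  move: tot; rewrite psumr_eq0; last by move=> i _; rewrite subr_ge0.
  by move=> /allP /(_ s'); rewrite mem_index_enum subr_eq0 => /(_ isT) /eqP.
exists (fun s => `|v s| / S); split.
- by move=> s; rewrite divr_ge0 ?normr_ge0 // ltW.
- by rewrite -mulr_suml divff.
- move=> s'; rewrite -abs mulr_suml; apply: eq_bigr => s _; ring.
Qed.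

Lemma stationaryP (R : realType) (T : finType) (P : T -> T -> R) (s0 : T) :
  stochastic P -> is_stationary P (stationary P).
Proof. by move=> sP; apply: xgetPex; exact: stationary_exists sP. Qed.

Lemma tstep_markov_op (R : realType) (T : finType) (P : T -> T -> R) t f s :
  \sum_s' tstep P t s s' * f s' = iter t (markov_op P) f s.
Proof.
elim: t s => [|t IH] s /=.
  rewrite (bigD1 s) //= eqxx mul1r big1 ?addr0 // => i si.
  by rewrite eq_sym (negPf si) mul0r.
under eq_bigr do rewrite mulr_suml.
rewrite exchange_big /=; apply: eq_bigr => u _; rewrite -IH mulr_sumr.
by apply: eq_bigr => i _; rewrite mulrA.
Qed.

Lemma iter_markov_op1 (R : realType) (T : finType) (P : T -> T -> R) t s :
  stochastic P -> iter t (markov_op P) (fun=> 1) s = 1.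
Proof.
move=> [_ P1]; elim: t s => //= t IH s; rewrite -[RHS](P1 s).
by apply: eq_bigr => u _; rewrite IH mulr1.
Qed.

Lemma stationary_markov_op (R : realType) (T : finType) (P : T -> T -> R) mu f :
  is_stationary P mu -> \sum_s mu s * markov_op P f s = \sum_s mu s * f s.
Proof.
move=> [_ _ muP]; rewrite /markov_op; under eq_bigr do rewrite mulr_sumr.
rewrite exchange_big /=; apply: eq_bigr => u _; rewrite -muP mulr_suml.
by apply: eq_bigr => i _; rewrite mulrA.
Qed.

Lemma stationary_iter_markov_op (R : realType) (T : finType) (P : T -> T -> R)
    mu t f :
  is_stationary P mu -> \sum_s mu s * iter t (markov_op P) f s = \sum_s mu s * f s.
Proof.
by move=> muP; elim: t => //= t IH; rewrite stationary_markov_op.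
Qed.

Lemma tv_dist_ge (R : realType) (T : finType) (p q : T -> R) (A : pred T) :
  \sum_s p s = \sum_s q s ->
  \sum_s p s * (A s)%:R - \sum_s q s * (A s)%:R <= tv_dist p q.
Proof.
move=> pq.
have d0 : 2^-1 * \sum_s (p s - q s) = 0 by rewrite sumrB pq subrr mulr0.
rewrite -[leLHS]subr0 -[X in _ - X <= _]d0 /tv_dist !mulr_sumr -!sumrB.
apply: ler_sum => s _.
have := ler_norm (p s - q s); have := ler_norm (- (p s - q s)).
rewrite normrN; case: (A s); rewrite /=; lra.
Qed.

(** The event [q s <= p s] is extremal: on it [p - q] sums to exactly the total variation
    distance. *)
Lemma tv_dist_le (R : realType) (T : finType) (p q : T -> R) (B : R) :
  \sum_s p s = \sum_s q s ->
  (forall A : pred T, \sum_s p s * (A s)%:R - \sum_s q s * (A s)%:R <= B) ->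
  tv_dist p q <= B.
Proof.
move=> pq /(_ [pred s | q s <= p s]) /=; apply: le_trans.
have d0 : 2^-1 * \sum_s (p s - q s) = 0 by rewrite sumrB pq subrr mulr0.
rewrite -[leRHS]subr0 -[X in _ <= _ - X]d0 /tv_dist !mulr_sumr -!sumrB.
apply: ler_sum => s _; have [le|lt] := leP (q s) (p s).
  by rewrite ger0_norm ?subr_ge0 //= ; lra.
by rewrite ltr0_norm ?subr_lt0 //= ; lra.
Qed.

(** By stationarity [mu] is the [mu]-average of the [t]-step laws over all starts [s'], so a bound
    uniform in [s'] survives the averaging. *)
Lemma tv_dist_stationary_le (R : realType) (T : finType) (P : T -> T -> R)
    (mu : T -> R) t s (B : R) :
  stochastic P -> is_stationary P mu ->
  (forall s' (A : pred T), iter t (markov_op P) (fun u => (A u)%:R) s -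
     iter t (markov_op P) (fun u => (A u)%:R) s' <= B) ->
  tv_dist (tstep P t s) mu <= B.
Proof.
move=> sP muP le; have [mu0 mu1 _] := muP; apply: tv_dist_le => [|A].
  rewrite mu1; have := iter_markov_op1 t s sP.
  by rewrite -tstep_markov_op; under eq_bigr do rewrite mulr1.
rewrite tstep_markov_op -(stationary_iter_markov_op t _ muP).
have avg c : c = \sum_i mu i * c by rewrite -mulr_suml mu1 mul1r.
rewrite [X in X - _]avg [leRHS]avg -sumrB.
by apply: ler_sum => s' _; rewrite -mulrBr ler_wpM2l.
Qed.

Lemma tv_dist_tstep_ge (R : realType) (T : finType) (P : T -> T -> R)
    (mu : T -> R) t s (A : pred T) :
  stochastic P -> is_stationary P mu ->
  \sum_u mu u * (A u)%:R - iter t (markov_op P) (fun u => (A u)%:R) s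
    <= tv_dist (tstep P t s) mu.
Proof.
move=> sP [_ mu1 _]; rewrite -tstep_markov_op.
have -> : tv_dist (tstep P t s) mu = tv_dist mu (tstep P t s).
  by congr (_ * _); apply: eq_bigr => u _; rewrite distrC.
apply: tv_dist_ge; rewrite mu1; have := iter_markov_op1 t s sP.
by rewrite -tstep_markov_op; under eq_bigr do rewrite mulr1.
Qed.

Lemma mixing_timeP (R : realType) (T : finType) (P : T -> T -> R) (e : R) :
  (exists t, worst_dist P t < e) ->
  worst_dist P (mixing_time P e) < e /\
    forall t, worst_dist P t < e -> (mixing_time P e <= t)%N.
Proof.
move=> ex; pose D := [set t | worst_dist P t < e /\
  forall t', worst_dist P t' < e -> (t <= t')%N].
have /(xgetPex 0%N) // : exists t, D t.
by case: (ex_minnP ex) => t te tmin; exists t.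
Qed.

(** * Unicycles *)

(** Following [rho] from any [v] ends in a cycle, which uniqueness forces to pass through [x].
    Conversely, every cycle is closed under [rho], so it contains [x] and is the orbit of [x] up to
    rotation. *)
Lemma is_unicycleP m (x : 'I_m) (rho : {ffun 'I_m -> 'I_m}) :
  is_unicycle x rho <-> forall v, fconnect rho v x.
Proof.
split=> [[c [[_ uc fc] xc cuniq]] v|tox].
  have /trajectP[i lti def] := looping_order rho v.
  pose u := iter i rho v.
  have uK : iter (order rho v - i) rho u = u.
    by rewrite /u -iterD subnK ?def // ltnW.
  have fu : fcycle rho (orbit rho u).
    apply/(orbitPcycle 0 3); exists (order rho v - i).-1.
    by rewrite prednK ?uK // subn_gt0.
  have [|j cE] := cuniq (orbit rho u).
    split=> //; last exact: orbit_uniq.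
    by rewrite -size_eq0 size_orbit -lt0n order_gt0.
  apply: (connect_trans (fconnect_iter _ i v)).
  by rewrite fconnect_orbit cE mem_rot.
have fx : fcycle rho (orbit rho x) by rewrite -fconnect_f.
exists (orbit rho x); split.
- split=> //; last exact: orbit_uniq.
  by rewrite -size_eq0 size_orbit -lt0n order_gt0.
- by rewrite -fconnect_orbit connect0.
- move=> c' [c'0 uc' fc'].
  have xc' : x \in c'.
    case: c' c'0 uc' fc' => // v s _ _ fc'.
    by rewrite -(fconnect_cycle fc' (mem_head v s)).
  have [i orbE] := orbit_rot_cycle fc' uc' xc'.
  (* This undoes [rot i]; if [i] exceeds the size, the truncated difference is 0 and both rotations
     are trivial. *)
  exists (size c' - i)%N; rewrite orbE.
  have [lei|gti] := leqP i (size c').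
    by rewrite -[LHS](rotK i) /rotr size_rot.
  by rewrite (eqP (ltnW gti)) rot0 rot_oversize // ltnW.
Qed.

(** The old path from [v], cut at its first visit to [x], uses no rewritten arrow; the new arrow
    then leads from [x] to [y]. *)
Lemma move_is_unicycle m (s : 'I_m * {ffun 'I_m -> 'I_m}) (y : 'I_m) :
  is_unicycle s.1 s.2 -> is_unicycle (move s y).1 (move s y).2.
Proof.
case: s => x rho /is_unicycleP /= tox; apply/is_unicycleP => v /=.
set eta := [ffun v => _].
suff vx : fconnect eta v x.
  by apply: connect_trans vx _; apply: connect1; rewrite /= ffunE eqxx.
have /iter_findex := tox v; move: (findex rho v x) => k.
elim: k v => [|k IH] v; first by move=> <- /=.
rewrite iterSr => /IH kx; have [->//|vNx] := eqVneq v x.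
by apply: connect_trans kx; apply: connect1; rewrite /= ffunE (negPf vNx).
Qed.

Definition umove m (s : unicycle m) (y : 'I_m) : unicycle m :=
  exist _ (move (val s) y) (asboolT (move_is_unicycle y (asboolW (valP s)))).

Definition const_unicycle m (v0 : 'I_m) : unicycle m.
Proof.
exists (v0, [ffun=> v0]); apply/asboolP/is_unicycleP => v /=.
by apply: connect1; rewrite /= ffunE.
Defined.

(** This form carries the coupling: averages for two walks are compared term by term, at the same
    [y]. *)
Lemma markov_op_unicycle (R : realType) m (f : unicycle m -> R) s :
  markov_op (@unicycle_walk m R) f s = m%:R^-1 * \sum_y f (umove s y).
Proof.
rewrite mulr_sumr /markov_op /unicycle_walk.
under eq_bigr do rewrite -sum1_card natr_sum mulrAC mulr_suml mulr_suml.
rewrite (exchange_big_dep predT) //=; apply: eq_bigr => y _.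
rewrite (eq_bigl (pred1 (umove s y))); last by move=> s'; rewrite /= -val_eqE.
by rewrite big_pred1_eq mul1r mulrC.
Qed.

Lemma unicycle_walk_stochastic (R : realType) m (v0 : 'I_m) :
  stochastic (@unicycle_walk m R).
Proof.
split=> [s s'|s]; first by rewrite /unicycle_walk divr_ge0.
have := markov_op_unicycle (fun=> 1 : R) s; rewrite /markov_op.
under eq_bigr do rewrite mulr1; move=> ->; rewrite sumr_const card_ord mulVf //.
by rewrite pnatr_eq0 -lt0n (leq_trans _ (ltn_ord v0)).
Qed.

(** * Upper bound by coupling *)

Lemma mean_const (R : realType) m (c : R) (v0 : 'I_m) :
  m%:R^-1 * \sum_(y < m) c = c.
Proof.
rewrite sumr_const card_ord -[c *+ m]mulr_natl mulKf //.
by rewrite pnatr_eq0 -lt0n (leq_trans _ (ltn_ord v0)).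
Qed.

Lemma mean_setD1 (R : realType) m (S : {set 'I_m}) (g : nat -> R) (v0 : 'I_m) :
  m%:R^-1 * \sum_y g #|S :\ y| =
  #|S|%:R / m%:R * g #|S|.-1 + (1 - #|S|%:R / m%:R) * g #|S|.
Proof.
have m0 : m%:R != 0 :> R.
  by rewrite pnatr_eq0 -lt0n (leq_trans _ (ltn_ord v0)).
rewrite (bigID (mem S)) /=.
rewrite (eq_bigr (fun=> g #|S|.-1)); last first.
  by move=> y yS; rewrite [in RHS](cardsD1 y S) yS.
rewrite [X in _ + X](eq_bigr (fun=> g #|S|)); last first.
  by move=> y yS; rewrite [in RHS](cardsD1 y S) (negPf yS).
rewrite sumr_const (eq_bigl (mem (~: S))); last by move=> y; rewrite !inE.
rewrite sumr_const -[g _.-1 *+ _]mulr_natl -[g _ *+ _]mulr_natl.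
have -> : #|~: S|%:R = m%:R - #|S|%:R :> R.
  by apply/eqP; rewrite eq_sym subr_eq -natrD addnC cardsC card_ord.
by field.
Qed.

(* Two walks at the same position x whose maps differ only inside S and at x, driven
   by the same random vertices: stepping from x overwrites the difference at x,
   so the walks have merged once S has been visited. *)
Lemma iter_markov_op_agree (R : realType) m (f : unicycle m -> R) t
    (s s' : unicycle m) (S : {set 'I_m}) :
  (forall u, 0 <= f u <= 1) -> (val s).1 = (val s').1 ->
  (forall v, v \notin S -> v != (val s).1 -> (val s).2 v = (val s').2 v) ->
  iter t.+1 (markov_op (@unicycle_walk m R)) f s -
  iter t.+1 (markov_op (@unicycle_walk m R)) f s' <=
    #|S|%:R * (1 - m%:R^-1) ^+ t.
Proof.
move=> f01; have v0 := (val s).1.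
have m0 : m%:R != 0 :> R.
  by rewrite pnatr_eq0 -lt0n (leq_trans _ (ltn_ord v0)).
elim: t s s' S => [|t IH] s s' S xx' agree.
  (* If [S] is empty, one step makes the states equal; otherwise [#|S| >= 1] bounds any difference
     of values in [0, 1]. *)
  rewrite expr0 mulr1 /= !markov_op_unicycle -mulrBr -sumrB.
  have -> : #|S|%:R = m%:R^-1 * \sum_(y < m) #|S|%:R :> R.
    by rewrite mean_const.
  rewrite ler_wpM2l ?invr_ge0 //; apply: ler_sum => y _.
  have [S0|[v vS]] := set_0Vmem S.
    suff -> : umove s y = umove s' y by rewrite subrr.
    apply: val_inj; congr (_, _); apply/ffunP => v; rewrite !ffunE -xx'.
    by case: eqVneq => // vx; apply: agree; rewrite // S0 inE.
  have : 1 <= #|S|%:R :> R by rewrite ler1n card_gt0; apply/set0Pn; exists v.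
  have := f01 (umove s y); have := f01 (umove s' y); lra.
rewrite iterS !markov_op_unicycle -mulrBr -sumrB.
(* With k the size of [S], (k/m)(k - 1) + (1 - k/m) k = k (1 - 1/m). *)
have -> : #|S|%:R * (1 - m%:R^-1) ^+ t.+1 =
    m%:R^-1 * \sum_y (#|S :\ y|%:R * (1 - m%:R^-1) ^+ t) :> R.
  rewrite (mean_setD1 S (fun k => k%:R * (1 - m%:R^-1) ^+ t) v0) exprS.
  by case: #|S| => [|k] /=; [ring | rewrite -natr1; field].
(* The vertex [y] may leave [S] because it is the new position, where the maps are allowed to
   differ. *)
rewrite ler_wpM2l ?invr_ge0 //; apply: ler_sum => y _; apply: IH => //= v vSy vy.
rewrite !ffunE -xx'; case: eqVneq => // vx; apply: agree => //.
by apply: contra vSy; rewrite !inE vy.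
Qed.

(** Of the [t.+2] steps, the first brings both walks to the same vertex, and the other [t.+1] are
    those of [iter_markov_op_agree] with [S] the whole vertex set. *)
Lemma iter_markov_op_diff (R : realType) m (f : unicycle m -> R) t
    (s s' : unicycle m) :
  (forall u, 0 <= f u <= 1) ->
  iter t.+2 (markov_op (@unicycle_walk m R)) f s -
  iter t.+2 (markov_op (@unicycle_walk m R)) f s' <=
    m%:R * (1 - m%:R^-1) ^+ t.
Proof.
move=> f01; have v0 := (val s).1.
have m0 : m%:R != 0 :> R.
  by rewrite pnatr_eq0 -lt0n (leq_trans _ (ltn_ord v0)).
rewrite iterS !markov_op_unicycle -mulrBr -sumrB.
have -> : m%:R * (1 - m%:R^-1) ^+ t =
    m%:R^-1 * \sum_(y < m) (m%:R * (1 - m%:R^-1) ^+ t) :> R.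
  by rewrite mean_const.
rewrite ler_wpM2l ?invr_ge0 //; apply: ler_sum => y _.
have := @iter_markov_op_agree R m f t (umove s y) (umove s' y) [set: 'I_m]%SET f01 erefl.
by rewrite cardsT card_ord; apply=> v; rewrite inE.
Qed.

Lemma worst_dist_unicycle_le (R : realType) m t (v0 : 'I_m) :
  worst_dist (@unicycle_walk m R) t.+2 <= m%:R * (1 - m%:R^-1) ^+ t.
Proof.
have sP := unicycle_walk_stochastic R v0.
(* The default value 0 of the maximum must also lie below the bound. *)
apply: bigmax_le => [|s _].
  rewrite mulr_ge0 // exprn_ge0 // subr_ge0 invf_le1 ?ltr0n ?ler1n.
    exact: leq_trans (ltn_ord v0).
  exact: leq_trans (ltn_ord v0).
apply: tv_dist_stationary_le => // [|s' A].
  exact: stationaryP (const_unicycle v0) sP.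
by apply: iter_markov_op_diff => u; rewrite ler0n lern1 leq_b1.
Qed.

(** * Lower bound by counting unvisited vertices *)

Definition remove_op (R : realType) m (h : {set 'I_m} -> R) (S : {set 'I_m}) : R :=
  m%:R^-1 * \sum_y h (S :\ y).

(* k and k (k - 1) are eigenfunctions of the number k of unvisited vertices,
   with eigenvalues 1 - 1/m and 1 - 2/m. *)
Lemma iter_remove_op (R : realType) m (v0 : 'I_m) (a b c : R) t (S : {set 'I_m}) :
  iter t (@remove_op R m)
    (fun S => a * (#|S|%:R * (#|S|%:R - 1)) + b * #|S|%:R + c) S =
  a * (1 - 2 / m%:R) ^+ t * (#|S|%:R * (#|S|%:R - 1)) +
  b * (1 - m%:R^-1) ^+ t * #|S|%:R + c.
Proof.
have m0 : m%:R != 0 :> R.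
  by rewrite pnatr_eq0 -lt0n (leq_trans _ (ltn_ord v0)).
elim: t S => [|t IH] S; first by rewrite /= !mulr1.
rewrite iterS /remove_op; under eq_bigr do rewrite IH.
rewrite (mean_setD1 S (fun k => a * (1 - 2 / m%:R) ^+ t * (k%:R * (k%:R - 1)) +
  b * (1 - m%:R^-1) ^+ t * k%:R + c) v0) !exprS.
by case: #|S| => [|k] /=; [field | rewrite -!natr1; field].
Qed.

(** Comparison with the coupon collector chain [remove_op]: since the position is outside [S], the
    arrow being rewritten is not one of those counted, and removing the new position [y] restores
    the invariant. *)
Lemma iter_markov_op_unvisited (R : realType) m (v0 : 'I_m) f h t
    (s : unicycle m) (S : {set 'I_m}) :
  let unvisited (s : unicycle m) (S : {set 'I_m}) :=
    [/\ v0 \notin S, (val s).1 \notin S & forall v, v \in S -> (val s).2 v = v0] in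
  (forall s S, unvisited s S -> f s <= h S) -> unvisited s S ->
  iter t (markov_op (@unicycle_walk m R)) f s <= iter t (@remove_op R m) h S.
Proof.
move=> unvisited fh; elim: t s S => [|t IH] s S sS; first exact: fh.
rewrite !iterS markov_op_unicycle /remove_op ler_wpM2l ?invr_ge0 //.
apply: ler_sum => y _; apply: IH; case: sS => v0S xS Sv0; split => /=.
- by rewrite !inE negb_and v0S orbT.
- by rewrite !inE eqxx.
- move=> v; rewrite !inE ffunE => /andP[_ vS]; case: eqVneq => [vx|_].
    by rewrite -vx vS in xS.
  exact: Sv0.
Qed.

Definition in_neighbours m (v0 : 'I_m) (s : unicycle m) : nat :=
  #|[set v | (v != v0) && ((val s).2 v == v0)]%SET|.

(** Chebyshev's inequality: the number of unvisited vertices has mean [a] and variance at most [a],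
    and it bounds [in_neighbours] from below. *)
Lemma iter_markov_op_in_neighbours (R : realType) m (v0 : 'I_m) t
    (a : R := m.-1%:R * (1 - m%:R^-1) ^+ t) :
  (1 < m)%N ->
  iter t (markov_op (@unicycle_walk m R))
    (fun s => (2 * (in_neighbours v0 s)%:R <= a)%R%:R) (const_unicycle v0) <= 4 / a.
Proof.
move=> m1.
have m0 : 0 < m%:R :> R by rewrite ltr0n ltnW.
have iv1 : m%:R^-1 < 1 :> R by rewrite invf_lt1 ?ltr1n.
have iv2 : 2 / m%:R <= 1 :> R by rewrite ler_pdivrMr // mul1r ler_nat.
have iv0 : 0 < m%:R^-1 :> R by rewrite invr_gt0.
have a0 : 0 < a by rewrite mulr_gt0 ?exprn_gt0 ?subr_gt0 // ltr0n -ltnS prednK // ltnW.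
(* The Chebyshev weight of [hE], expanded in k (k - 1), k and 1 so that [iter_remove_op] applies. *)
pose h (S : {set 'I_m}) : R := 4 / a ^+ 2 * (#|S|%:R * (#|S|%:R - 1)) +
   (4 / a ^+ 2 * (1 - 2 * a)) * #|S|%:R + 4.
have hE S : h S = 4 / a ^+ 2 * (#|S|%:R - a) ^+ 2.
  by rewrite /h; field; rewrite gt_eqF.
apply: le_trans (iter_markov_op_unvisited (v0 := v0) (h := h) (S := [set~ v0]) _ _ _) _.
- move=> s S [v0S _ Sv0]; rewrite hE.
  have c0 : 0 <= 4 / a ^+ 2 by rewrite divr_ge0 // sqr_ge0.
  have [le|_] := boolP (_ <= a); last by rewrite mulr_ge0 // sqr_ge0.
  have SD : #|S|%:R <= (in_neighbours v0 s)%:R :> R.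
    have sub : S \subset [set v | (v != v0) && ((val s).2 v == v0)]%SET.
      apply/fintype.subsetP => v vS; rewrite inE (Sv0 _ vS) eqxx andbT.
      by apply: contraNneq v0S => <-.
    by rewrite ler_nat subset_leq_card.
  rewrite mulrAC ler_pdivlMr ?exprn_gt0 // mul1r; nra.
- by split => /=; rewrite ?inE ?eqxx // => v; rewrite ffunE.
- rewrite /h iter_remove_op // cardsC1 card_ord.
  set n := m.-1%:R.
  have n0 : 0 <= n :> R by rewrite /n.
  set q := 1 - m%:R^-1 in a a0 h hE *; set r := 1 - 2 / m%:R.
  (* Negative correlation of two vertices staying unvisited, from 1 - 2/m <= (1 - 1/m)^2; it yields
     the variance bound. *)
  have rq : r ^+ t <= (q ^+ t) ^+ 2.
    rewrite exprAC; apply: lerXn2r; rewrite ?nnegrE ?sqr_ge0 /r ?subr_ge0 //.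
    by rewrite /q; nra.
  have r0 : 0 <= r ^+ t by rewrite exprn_ge0 // subr_ge0.
  have -> : 4 / a ^+ 2 * r ^+ t * (n * (n - 1)) +
     4 / a ^+ 2 * (1 - 2 * a) * q ^+ t * n + 4 =
     4 / a + 4 / a ^+ 2 * (r ^+ t * (n * (n - 1)) - a ^+ 2).
    have -> : 4 / a ^+ 2 * (1 - 2 * a) * q ^+ t * n = 4 / a ^+ 2 * (1 - 2 * a) * a.
      by rewrite /a -/n; ring.
    by field; rewrite gt_eqF.
  rewrite gerDl mulr_ge0_le0 ?divr_ge0 ?sqr_ge0 // subr_le0 /a exprMn -/n.
  have : r ^+ t * (n * (n - 1)) <= r ^+ t * n ^+ 2.
    by rewrite ler_wpM2l //; nra.
  have : r ^+ t * n ^+ 2 <= (q ^+ t) ^+ 2 * n ^+ 2 by rewrite ler_wpM2r ?sqr_ge0.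
  lra.
Qed.

(* Applied to the indicators f1 of {x = v, rho v = v0}, f2 of {rho v = v0} and
   f3 of {x = v}, stationarity and f2 = f1 + m A f1, A f2 = m A f1 + f3 / m,
   A f3 = 1 / m determine all three expectations. *)
Lemma stationary_edge (R : realType) m (mu : unicycle m -> R) (v0 v : 'I_m) :
  is_stationary (@unicycle_walk m R) mu -> v != v0 ->
  \sum_s mu s * ((val s).2 v == v0)%:R = (1 + m%:R) / m%:R ^+ 2.
Proof.
move=> muP vv0; have [_ mu1 _] := muP.
have m0 : m%:R != 0 :> R.
  by rewrite pnatr_eq0 -lt0n (leq_trans _ (ltn_ord v0)).
set A := markov_op (@unicycle_walk m R).
pose f1 (s : unicycle m) : R := (((val s).1 == v) && ((val s).2 v == v0))%:R.
pose f2 (s : unicycle m) : R := ((val s).2 v == v0)%:R.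
pose f3 (s : unicycle m) : R := ((val s).1 == v)%:R.
have one w : \sum_(y < m) (y == w)%:R = 1 :> R.
  by rewrite (bigD1 w) //= eqxx big1 ?addr0 // => y /negPf ->.
have A3 s : A f3 s = m%:R^-1 by rewrite /A markov_op_unicycle /f3 /= one mulr1.
have A1 s : A f1 s = m%:R^-1 * (((val s).1 != v) && ((val s).2 v == v0))%:R.
  rewrite /A markov_op_unicycle /f1 /=; congr (_ * _).
  rewrite (bigD1 v) //= eqxx big1 ?addr0 => [|y /negPf -> //].
  by rewrite ffunE [v == _]eq_sym; case: (eqVneq (val s).1 v) => //= _; rewrite (negPf vv0).
have A2 s : A f2 s = m%:R * A f1 s + m%:R^-1 * f3 s.
  rewrite A1 mulrA divff // mul1r /A markov_op_unicycle /f2 /f3 /=.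
  under eq_bigr do rewrite ffunE eq_sym [v == _]eq_sym.
  case: (eqVneq (val s).1 v) => /= _; first by under eq_bigr do rewrite eq_sym; rewrite one add0r.
  rewrite mean_const // mulr0 addr0.
  by rewrite eq_sym.
have E2 : \sum_s mu s * f2 s = \sum_s mu s * f1 s + m%:R * \sum_s mu s * A f1 s.
  rewrite mulr_sumr -big_split; apply: eq_bigr => s _ /=.
  rewrite A1 /f1 /f2; case: (eqVneq (val s).1 v) => /= _; field => //.
have E3 : \sum_s mu s * f3 s = m%:R^-1.
  rewrite -(stationary_markov_op f3 muP) -/A; under eq_bigr do rewrite A3.
  by rewrite -mulr_suml mu1 mul1r.
have E2' : \sum_s mu s * f2 s =
    m%:R * \sum_s mu s * A f1 s + m%:R^-1 * \sum_s mu s * f3 s.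
  rewrite -(stationary_markov_op f2 muP) -/A !mulr_sumr -big_split.
  by apply: eq_bigr => s _ /=; rewrite A2; ring.
(* Equating [E2] and [E2'] cancels the common term in [A f1]. *)
have E1 : \sum_s mu s * f1 s = m%:R^-1 * m%:R^-1.
  by rewrite -{2}E3; apply: (addIr (m%:R * \sum_s mu s * A f1 s)); rewrite -E2 E2' addrC.
by rewrite E2 (stationary_markov_op f1 muP) E1; field.
Qed.

Lemma stationary_in_neighbours (R : realType) m (mu : unicycle m -> R) (v0 : 'I_m) :
  is_stationary (@unicycle_walk m R) mu ->
  \sum_s mu s * (in_neighbours v0 s)%:R <= 1.
Proof.
move=> muP.
have m0 : 0 < m%:R :> R by rewrite ltr0n (leq_trans _ (ltn_ord v0)).
have -> : \sum_s mu s * (in_neighbours v0 s)%:R =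
    \sum_(v | v != v0) \sum_s mu s * ((val s).2 v == v0)%:R.
  rewrite exchange_big /=; apply: eq_bigr => s _; rewrite -mulr_sumr; congr (_ * _).
  rewrite /in_neighbours -sum1_card natr_sum.
  rewrite (eq_bigl (fun v => (v != v0) && ((val s).2 v == v0))).
    by rewrite big_mkcondr; apply: eq_bigr => v _; case: eqP.
  by move=> v; rewrite inE.
rewrite (eq_bigr (fun=> (1 + m%:R) / m%:R ^+ 2)); last first.
  by move=> v; exact: stationary_edge.
rewrite sumr_const cardC1 card_ord -[_ *+ m.-1]mulr_natl mulrA ler_pdivrMr ?exprn_gt0 //.
rewrite -subn1 natrB ?(leq_trans _ (ltn_ord v0)) //; nra.
Qed.

(** The event [2 * in_neighbours <= a] separates the laws: it has probability at most 4/a for the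
    walk and, by Markov's inequality, at least 1 - 2/a under [mu]. *)
Lemma worst_dist_unicycle_ge (R : realType) m (v0 : 'I_m) t : (1 < m)%N ->
  1 - 6 / (m.-1%:R * (1 - m%:R^-1) ^+ t) <= worst_dist (@unicycle_walk m R) t.
Proof.
move=> m1; set a : R := m.-1%:R * _.
have m0 : 0 < m%:R :> R by rewrite ltr0n ltnW.
have iv1 : m%:R^-1 < 1 :> R by rewrite invf_lt1 ?ltr1n.
have a0 : 0 < a by rewrite mulr_gt0 ?exprn_gt0 ?subr_gt0 // ltr0n -ltnS prednK // ltnW.
have sP := unicycle_walk_stochastic R v0.
have muP := stationaryP (const_unicycle v0) sP; set mu := stationary _ in muP.
have [mu0 mu1 _] := muP.
apply: le_trans (le_bigmax _ _ (const_unicycle v0)).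
apply: le_trans (tv_dist_tstep_ge _ _
  [pred s | 2 * (in_neighbours v0 s)%:R <= a] sP muP).
have -> : 1 - 6 / a = (1 - 2 / a * 1) - 4 / a by field; rewrite gt_eqF.
apply: lerB; last exact: iter_markov_op_in_neighbours.
apply: le_trans (_ : \sum_u mu u - 2 / a * \sum_u mu u * (in_neighbours v0 u)%:R <= _).
  by rewrite mu1 lerB // ler_wpM2l ?stationary_in_neighbours // divr_ge0 ?ltW.
(* Markov's inequality termwise: 1 - 2N/a is at most the indicator of 2N <= a. *)
rewrite mulr_sumr -sumrB; apply: ler_sum => s _ /=.
have -> : mu s - 2 / a * (mu s * (in_neighbours v0 s)%:R) =
  mu s * (1 - 2 * (in_neighbours v0 s)%:R / a) by field; rewrite gt_eqF.
rewrite ler_wpM2l //; have [le|gt] := leP (2 * (in_neighbours v0 s)%:R) a.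
  by rewrite gerBl divr_ge0 ?(ltW a0) ?mulr_ge0.
by rewrite mulr0n subr_le0 ler_pdivlMr // mul1r ltW.
Qed.

(** * Cutoff *)

Lemma unicycle_tmix_bounds (R : realType) (d e : R) :
  0 < d <= 1 -> 0 < e < 1 ->
  \forall m \near \oo, (1 - d) * (m%:R * ln m%:R) <= (unicycle_tmix m e)%:R
                    <= (1 + d) * (m%:R * ln m%:R).
Proof.
move=> /andP[d0 d1] /andP[e0 e1].
have lnoo (A : R) : \forall m \near \oo, A <= ln (m%:R : R).
  near=> m; rewrite -(expRK A) ler_ln ?posrE ?expR_gt0 //; last first.
    by rewrite ltr0n; near: m; exists 1%N.
  by near: m; exact: nbhs_infty_ger.
near=> m.
have m2 : (1 < m)%N by near: m; exists 2%N.
have v0 : 'I_m by exact: (Ordinal m2).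
(* With L = ln m, the lower estimate will need [12 / (1 - e) <= expR (d * L - 1)] and the upper one
   [expR (2 - d * L) < e]. *)
have : (ln (12 / (1 - e)) + 2) / d <= ln (m%:R : R) by near: m; exact: lnoo.
have : (4 - ln e) / d <= ln (m%:R : R) by near: m; exact: lnoo.
have : 1 <= ln (m%:R : R) by near: m; exact: lnoo.
set L := ln (m%:R : R) => L3 L2 L1; set M : R := m%:R.
have M2 : 2 <= M by rewrite ler_nat.
have M0 : 0 < M by lra.
have EL : expR L = M by rewrite lnK // posrE.
have L4 : L <= M - 1.
  by have := @le_ln1Dx R (M - 1); rewrite [1 + _]addrC subrK; apply; lra.
rewrite ler_pdivrMr // in L1; rewrite ler_pdivrMr // in L2.
pose t := Num.truncn ((1 + d) * (M * L)).
have X0 : 0 <= (1 + d) * (M * L).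
  by rewrite !mulr_ge0 // ?ltW //; lra.
have /andP[tle tgt] := truncn_itv X0; rewrite -/t in tle tgt.
have t2 : (2 <= t)%N.
  rewrite truncn_ge_nat //; have : 2 <= M * L by nra.
  nra.
have up : worst_dist (@unicycle_walk m R) t < e.
  rewrite -(subnK t2) addn2; apply: le_lt_trans (worst_dist_unicycle_le _ _ v0) _.
  have q1 : 1 - M^-1 <= expR (- M^-1) by exact: expR_ge1Dx.
  have q0 : 0 <= 1 - M^-1 by rewrite subr_ge0 invf_le1 //; lra.
  have : (1 - M^-1) ^+ (t - 2) <= expR (- M^-1 * (t - 2)%:R).
    by rewrite expRM_natr lerXn2r ?nnegrE // expR_ge0.
  (* Rounding [t] down and dropping two steps cost at most 3/M in the exponent, which is below 2. *)
  have le : - M^-1 * (t - 2)%:R <= - (1 + d) * L + 2.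
    have : (1 + d) * L - 2 <= (t - 2)%:R / M.
      rewrite natrB // ler_pdivlMr //.
      have : (1 + d) * (M * L) < t%:R + 1 by rewrite natr1.
      nra.
    by rewrite [_ / M]mulrC; lra.
  rewrite -ler_expR in le => le2; have {le le2} := le_trans le2 le.
  rewrite -(ler_pM2l M0) => /le_lt_trans; apply.
  rewrite -{1}EL -expRD -[ltRHS]lnK ?posrE // ltr_expR; lra.
have lo : forall s, s%:R <= (1 - d) * (M * L) ->
    e <= worst_dist (@unicycle_walk m R) s.
  move=> s sle; apply: le_trans (worst_dist_unicycle_ge R v0 s m2).
  have PM : m.-1%:R = M - 1 :> R by rewrite -subn1 natrB // ltnW.
  rewrite PM -/M.
  have q1 : expR (- (M - 1)^-1) <= 1 - M^-1.
    have -> : 1 - M^-1 = (1 + (M - 1)^-1)^-1.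
      by field; rewrite !gt_eqF //; lra.
    rewrite expRN lef_pV2 ?posrE ?expR_gt0 ?expR_ge1Dx // addr_gt0 // invr_gt0; lra.
  have le : 12 / (1 - e) <= 2 * (M - 1) * (1 - M^-1) ^+ s.
    have le1 : expR (- (M - 1)^-1 * s%:R) <= (1 - M^-1) ^+ s.
      rewrite expRM_natr lerXn2r ?nnegrE ?expR_ge0 //.
      exact: le_trans (expR_ge0 _) q1.
    have le2 : - (1 - d) * L - 1 <= - (M - 1)^-1 * s%:R.
      (* Replacing M by M - 1 in the denominator adds (1 - d) L / (M - 1), at most 1 by [L4]. *)
      have : s%:R / (M - 1) <= (1 - d) * L + 1.
        have dL : 0 <= d * L by rewrite mulr_ge0 ?ltW //; lra.
        rewrite ler_pdivrMr; last by lra.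
        by apply: le_trans sle _; rewrite -subr_ge0; lra.
      by rewrite [_ / (M - 1)]mulrC; lra.
    rewrite -ler_expR in le2; have {le1 le2} le3 := le_trans le2 le1.
    (* The factor 2, hence 12 in place of 6, pays for M <= 2 (M - 1). *)
    apply: le_trans (_ : M * expR (- (1 - d) * L - 1) <= _).
      rewrite -{1}EL -expRD -[leLHS]lnK ?posrE ?divr_gt0 ?subr_gt0 // ler_expR.
      lra.
    by apply: ler_pM le3; [exact: ltW | exact: expR_ge0 | lra].
  set a := (M - 1) * _; have {}le : 6 / (1 - e) <= a.
    by move: le; rewrite /a -mulrA; lra.
  have a0 : 0 < a by apply: lt_le_trans le; rewrite divr_gt0 // subr_gt0.
  rewrite lerBrDl -lerBrDr ler_pdivrMr // mulrC -ler_pdivrMr ?subr_gt0 //.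
have [tm_lt tm_le] := mixing_timeP (ex_intro _ t up).
apply/andP; split; last by apply: le_trans tle; rewrite ler_nat tm_le.
(* [lo] covers every time up to the threshold, in particular the mixing time if it were that
   small. *)
by rewrite leNgt; apply/negP => /ltW /lo; rewrite leNgt tm_lt.
Unshelve. all: by end_near.
Qed.

Lemma unicycle_tmix_cvg (R : realType) (e : R) : 0 < e < 1 ->
  ((fun m : nat =>
      (unicycle_tmix m e)%:R / (m%:R * ln m%:R) : R) @ \oo --> (1 : R)).
Proof.
move=> e01; apply/cvgrPdist_le => d d0.
have d01 : 0 < Num.min d 1 <= 1 by rewrite lt_min d0 ltr01 ge_min lexx orbT.
near=> m.
have m2 : (1 < m)%N by near: m; exists 2%N.
have pos : 0 < m%:R * ln (m%:R : R).
  by rewrite mulr_gt0 ?ln_gt0 ?ltr1n // ltr0n ltnW.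
have : (1 - Num.min d 1) * (m%:R * ln m%:R) <= (unicycle_tmix m e)%:R
    <= (1 + Num.min d 1) * (m%:R * ln m%:R).
  by near: m; exact: unicycle_tmix_bounds.
case/andP; rewrite -ler_pdivlMr // => lo up.
have {}up : (unicycle_tmix m e)%:R / (m%:R * ln m%:R) <= 1 + Num.min d 1.
  by rewrite ler_pdivrMr.
have md : Num.min d 1 <= d by rewrite ge_min lexx.
by rewrite ler_norml; apply/andP; split; lra.
Unshelve. all: by end_near.
Qed.

Theorem theorem1p2 (R : realType) (e : R) (he0 : 0 < e) (he1 : e < 1) :
  ((fun m : nat =>
      (unicycle_tmix m e)%:R / (unicycle_tmix m (1 - e))%:R : R) @ \oo
     --> (1 : R)) /\
  ((fun m : nat =>
      (unicycle_tmix m e)%:R / (m%:R * ln m%:R) : R) @ \oo --> (1 : R)).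
Proof.
have cv1 : 0 < e < 1 by rewrite he0.
have cv2 : 0 < 1 - e < 1 by apply/andP; split; lra.
split; last exact: unicycle_tmix_cvg.
(* The two normalised limits, at [e] and [1 - e], are divided; the common factor m log m cancels
   once m >= 2. *)
have lim := cvgM (unicycle_tmix_cvg cv1) (cvgV (oner_neq0 _) (unicycle_tmix_cvg cv2)).
rewrite invr1 mulr1 in lim.
apply: (cvg_trans _ (lim _ _)); apply: near_eq_cvg; near=> m => /=.
have m2 : (1 < m)%N by near: m; exists 2%N.
have pos : m%:R * ln (m%:R : R) != 0.
  by rewrite gt_eqF // mulr_gt0 ?ln_gt0 ?ltr1n // ltr0n ltnW.
by rewrite invf_div mulrA divfK.
Unshelve. all: by end_near.
Qed.
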